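(* Let $S=M_{d_1}(\mathbb{C})\oplus\dots\oplus M_{d_k}(\mathbb{C})$ and let $T=M_{e_1}(\mathbb{C})\oplus\dots\oplus M_{e_\ell}(\mathbb{C})$ be a finite dimensional semi-simple unital subalgebra of $S$ whose Bratteli diagram with respect to $S$ is $(a_{ij})_{1\le i\le k,\,1\le j\le \ell}$. Let $\mathrm{Der}_T(S,S\otimes S)$ be the $S$-bimodule of $T$-linear double derivations of $S$. Then $$\mathrm{Der}_T(S,S\otimes S)\;\cong\;\bigoplus_{i=1}^k M_{d_i}(\mathbb{C})^{\oplus r_i}\;\oplus\;\bigoplus_{i\neq j}M_{d_i\times d_j}(\mathbb{C})^{\oplus r_{ij}}$$ as $S$-bimodules, where $r_i=\left(\sum_{u=1}^{\ell}a_{iu}^2\right)-1$ and $r_{ij}=\sum_{u=1}^{\ell}a_{iu}a_{ju}$, and the second sum runs over ordered pairs $(i,j)$ with $1\le i\ne j\le k$.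
   Context: $\mathbb{C}$ denotes an algebraically closed field of characteristic $0$, $\otimes=\otimes_{\mathbb{C}}$. A double derivation of $S$ is a $\mathbb{C}$-linear derivation $\vartheta:S\to S\otimes S$ for the outer bimodule structure $a\cdot(a'\otimes a'')\cdot b=(aa')\otimes(a''b)$. It is called $T$-linear if $\vartheta(T)=0$. The $S$-bimodule structure on double derivations is the inner one: $(s\vartheta t)(u)=\vartheta(u)'t\otimes s\vartheta(u)''$ (Sweedler notation). On the right hand side $S$ acts by matrix multiplication: $(s_1,\dots,s_k)$ acts on the left of $M_{d_i}(\mathbb{C})$ and $M_{d_i\times d_j}(\mathbb{C})$ by multiplication with $s_i$, and $(t_1,\dots,t_k)$ acts on the right of $M_{d_i}(\mathbb{C})$ by multiplication with $t_i$ and of $M_{d_i\times d_j}(\mathbb{C})$ by multiplication with $t_j$. The entry $a_{ij}$ of the Bratteli diagram is the multiplicity of the component $M_{e_j}(\mathbb{C})$ of $T$ in the component $M_{d_i}(\mathbb{C})$ of $S$ (so $d_i=\sum_{j}a_{ij}e_j$). *)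

(* Defs.v *)
From HB Require Import structures.
From mathcomp Require Import all_boot all_order all_algebra.
From mathcomp Require Import boolp.

Set Implicit Arguments.
Unset Strict Implicit.
Unset Printing Implicit Defensive.

Import GRing.Theory VectorInternalTheory.
Local Open Scope ring_scope.

Definition dirsum (I : finType) (V : I -> Type) : Type :=
  {dffun forall i : I, V i}.

HB.instance Definition _ (I : finType) (V : I -> choiceType) :=
  Choice.on (dirsum V).

Section DirsumZmodule.
Variables (I : finType) (V : I -> zmodType).
Implicit Types x y : dirsum V.

Definition dirsum_zero : dirsum V := [ffun i => 0].
Definition dirsum_opp x : dirsum V := [ffun i => - x i].
Definition dirsum_add x y : dirsum V := [ffun i => x i + y i].

Fact dirsum_addA : associative dirsum_add.
Proof. by move=> x y z; apply/ffunP=> i; rewrite !ffunE addrA. Qed.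
Fact dirsum_addC : commutative dirsum_add.
Proof. by move=> x y; apply/ffunP=> i; rewrite !ffunE addrC. Qed.
Fact dirsum_add0 : left_id dirsum_zero dirsum_add.
Proof. by move=> x; apply/ffunP=> i; rewrite !ffunE add0r. Qed.
Fact dirsum_addN : left_inverse dirsum_zero dirsum_opp dirsum_add.
Proof. by move=> x; apply/ffunP=> i; rewrite !ffunE addNr. Qed.

HB.instance Definition _ := GRing.isZmodule.Build (dirsum V)
  dirsum_addA dirsum_addC dirsum_add0 dirsum_addN.

Lemma dirsum0E i : (0 : dirsum V) i = 0. Proof. exact: ffunE. Qed.
Lemma dirsumNE x i : (- x) i = - x i. Proof. exact: ffunE. Qed.
Lemma dirsumDE x y i : (x + y) i = x i + y i. Proof. exact: ffunE. Qed.
End DirsumZmodule.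

Section DirsumLmodule.
Variables (R : pzRingType) (I : finType) (V : I -> lmodType R).
Implicit Types x y : dirsum V.

Definition dirsum_scale (c : R) x : dirsum V := [ffun i => c *: x i].

Fact dirsum_scaleA b c x :
  dirsum_scale b (dirsum_scale c x) = dirsum_scale (b * c) x.
Proof. by apply/ffunP=> i; rewrite !ffunE scalerA. Qed.
Fact dirsum_scale1 : left_id 1 dirsum_scale.
Proof. by move=> x; apply/ffunP=> i; rewrite !ffunE scale1r. Qed.
Fact dirsum_scaleDr : right_distributive dirsum_scale +%R.
Proof. by move=> c x y; apply/ffunP=> i; rewrite !ffunE scalerDr. Qed.
Fact dirsum_scaleDl x : {morph dirsum_scale^~ x : b c / b + c}.
Proof. by move=> b c; apply/ffunP=> i; rewrite !ffunE scalerDl. Qed.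

HB.instance Definition _ := GRing.Zmodule_isLmodule.Build R (dirsum V)
  dirsum_scaleA dirsum_scale1 dirsum_scaleDr dirsum_scaleDl.

Lemma dirsumZE c x i : (c *: x) i = c *: x i. Proof. exact: ffunE. Qed.
End DirsumLmodule.

Section DirsumVector.
Variables (F : fieldType) (I : finType) (V : I -> vectType F).

Fact dirsum_vect_iso :
  Vector.axiom #|{: {i : I & 'I_(dim (V i))}}| (dirsum V).
Proof.
pose f (x : dirsum V) : 'rV[F]_#|{: {i : I & 'I_(dim (V i))}}| :=
  \row_p v2r (x (tag (enum_val p))) ord0 (tagged (enum_val p)).
exists f.
  by move=> c x y; apply/rowP=> p; rewrite !mxE !ffunE linearP !mxE.
pose g (r : 'rV[F]_#|{: {i : I & 'I_(dim (V i))}}|) : dirsum V :=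
  [ffun i => r2v (\row_(j < dim (V i))
    r ord0 (enum_rank (Tagged (fun i => 'I_(dim (V i))) j)))].
exists g.
  move=> x; apply/ffunP=> i; rewrite ffunE; apply: (canLR v2rK).
  by apply/rowP=> j; rewrite !mxE enum_rankK.
move=> r; apply/rowP=> p; rewrite !mxE ffunE r2vK mxE.
by rewrite (_ : Tagged _ _ = enum_val p) ?enum_valK //; case: (enum_val p).
Qed.

HB.instance Definition _ :=
  Lmodule_hasFinDim.Build F (dirsum V) dirsum_vect_iso.
End DirsumVector.

Definition mxprod (F : fieldType) (k : nat) (d : 'I_k -> nat) : Type :=
  dirsum (fun i => 'M[F]_(d i)).

Section MxprodRing.
Variables (F : fieldType) (k : nat) (d : 'I_k -> nat).

HB.instance Definition _ := Vector.on (mxprod F d).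

Implicit Types x y : mxprod F d.

Definition mxprod_one : mxprod F d := [ffun i => 1%:M].
Definition mxprod_mul x y : mxprod F d := [ffun i => x i *m y i].

Fact mxprod_mulA : associative mxprod_mul.
Proof. by move=> x y z; apply/ffunP=> i; rewrite !ffunE mulmxA. Qed.
Fact mxprod_mul1 : left_id mxprod_one mxprod_mul.
Proof. by move=> x; apply/ffunP=> i; rewrite !ffunE mul1mx. Qed.
Fact mxprod_mulr1 : right_id mxprod_one mxprod_mul.
Proof. by move=> x; apply/ffunP=> i; rewrite !ffunE mulmx1. Qed.
Fact mxprod_mulDl : left_distributive mxprod_mul +%R.
Proof. by move=> x y z; apply/ffunP=> i; rewrite !ffunE mulmxDl. Qed.
Fact mxprod_mulDr : right_distributive mxprod_mul +%R.
Proof. by move=> x y z; apply/ffunP=> i; rewrite !ffunE mulmxDr. Qed.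

(* Not an nzRingType, hence not an algType: the blocks may have size 0. *)
HB.instance Definition _ := GRing.Zmodule_isPzRing.Build (mxprod F d)
  mxprod_mulA mxprod_mul1 mxprod_mulr1 mxprod_mulDl mxprod_mulDr.

Lemma mxprod1E i : (1 : mxprod F d) i = 1%:M. Proof. exact: ffunE. Qed.
Lemma mxprodME x y i : (x * y) i = x i *m y i. Proof. exact: ffunE. Qed.

Definition lmul x y := x * y.
Definition rmul x y := y * x.

Fact lmul_linear x : linear (lmul x).
Proof.
by move=> c y z; apply/ffunP=> i; rewrite !(ffunE, mxprodME) linearP.
Qed.
Fact rmul_linear x : linear (rmul x).
Proof.
move=> c y z; apply/ffunP=> i.
by rewrite !(ffunE, mxprodME) mulmxDl scalemxAl.
Qed.

HB.instance Definition _ x := GRing.isLinear.Build F (mxprod F d)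
  (mxprod F d) *:%R (lmul x) (lmul_linear x).
HB.instance Definition _ x := GRing.isLinear.Build F (mxprod F d)
  (mxprod F d) *:%R (rmul x) (rmul_linear x).
End MxprodRing.

Section Tensor.
Variable F : fieldType.

(* A tensor is encoded by its matrix of coordinates in the basis
   (e_i \otimes f_j) given by the canonical bases of the two factors;
   tensor_universal below is the universal property. *)
Definition tensor (V W : vectType F) : Type := 'M[F]_(dim V, dim W).
HB.instance Definition _ (V W : vectType F) := Vector.on (tensor V W).

Definition tens (V W : vectType F) (v : V) (w : W) : tensor V W :=
  (v2r v)^T *m v2r w.

(* f \otimes g; only meaningful for linear f and g. *)
Definition tmap (V V' W W' : vectType F) (f : V -> V') (g : W -> W')
    (x : tensor V W) : tensor V' W' :=
  (lin1_mx (v2r \o f \o r2v))^T *m x *m lin1_mx (v2r \o g \o r2v).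

Variables V W : vectType F.

Lemma tens_linearl (w : W) : linear ((@tens V W)^~ w).
Proof. by move=> c x y; rewrite /tens !linearP mulmxDl scalemxAl. Qed.

Lemma tens_linearr (v : V) : linear (@tens V W v).
Proof. by move=> c x y; rewrite /tens !linearP. Qed.

Lemma tmap_linear (V' W' : vectType F) (f : V -> V') (g : W -> W') : linear (tmap f g).
Proof. by move=> c x y; rewrite /tmap linearP mulmxDl -scalemxAl. Qed.

Lemma tmapE (V' W' : vectType F) (f : {linear V -> V'}) (g : {linear W -> W'})
  v w : tmap f g (tens v w) = tens (f v) (g w).
Proof.
have fE (X Y : vectType F) (h : {linear X -> Y}) x :
    v2r x *m lin1_mx (v2r \o h \o r2v) = v2r (h x).
  by rewrite mul_rV_lin1 /= v2rK.
by rewrite /tmap /tens !mulmxA -trmx_mul fE -mulmxA fE.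
Qed.

Definition tbasis i j : tensor V W :=
  tens (r2v (delta_mx 0 i) : V) (r2v (delta_mx 0 j) : W).

Lemma tbasisE i j : tbasis i j = delta_mx i j.
Proof. by rewrite /tbasis /tens !r2vK trmx_delta mul_delta_mx. Qed.

Lemma tensor_expand (x : tensor V W) :
  x = \sum_i \sum_j x i j *: tbasis i j.
Proof.
rewrite {1}(matrix_sum_delta x); apply: eq_bigr => i _; apply: eq_bigr => j _.
by rewrite tbasisE.
Qed.

Lemma tensor_ext (U : lmodType F) (f g : {linear tensor V W -> U}) :
  (forall v w, f (tens v w) = g (tens v w)) -> f =1 g.
Proof.
move=> fg x; rewrite (tensor_expand x) !linear_sum; apply: eq_bigr => i _.
by rewrite !linear_sum; apply: eq_bigr => j _; rewrite !linearZ /= fg.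
Qed.

Lemma tensor_universal (U : lmodType F) (b : V -> W -> U) :
    (forall w, linear (b^~ w)) -> (forall v, linear (b v)) ->
  exists2 f : {linear tensor V W -> U}, forall v w, f (tens v w) = b v w
    & forall g : {linear tensor V W -> U},
        (forall v w, g (tens v w) = b v w) -> g =1 f.
Proof.
move=> bl br.
pose bL w := HB.pack_for {linear V -> U} (b^~ w)
  (GRing.isLinear.Build F V U *:%R (b^~ w) (bl w)).
pose bR v := HB.pack_for {linear W -> U} (b v)
  (GRing.isLinear.Build F W U *:%R (b v) (br v)).
pose h (x : tensor V W) : U := \sum_i \sum_j x i j *:
  b (r2v (delta_mx 0 i)) (r2v (delta_mx 0 j)).
have hlin : linear h.
  move=> c x y; rewrite /h scaler_sumr -big_split; apply: eq_bigr => i _.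
  rewrite scaler_sumr -big_split; apply: eq_bigr => j _.
  by rewrite !mxE scalerDl scalerA.
pose hL := HB.pack_for {linear tensor V W -> U} h
  (GRing.isLinear.Build F (tensor V W) U *:%R h hlin).
have hE v w : hL (tens v w) = b v w.
  have vE (X : vectType F) (x : X) :
      x = \sum_i v2r x 0 i *: r2v (delta_mx 0 i).
    rewrite -{1}(v2rK x) {1}(row_sum_delta (v2r x)) linear_sum.
    by apply: eq_bigr => i _; rewrite linearZ.
  have fs (X : vectType F) (f : {linear X -> U}) n (c : 'I_n -> F) x :
      f (\sum_i c i *: x i) = \sum_i c i *: f (x i).
    by rewrite linear_sum; apply: eq_bigr => i _; rewrite linearZ.
  rewrite {2}(vE _ v) -[RHS]/(bL w _) fs; apply: eq_bigr => i _.
  rewrite /= {2}(vE _ w) -[b _ _]/(bR _ _) fs scaler_sumr; apply: eq_bigr => j _.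
  by rewrite scalerA /tens mxE big_ord1 mxE.
by exists hL => // g gE; apply: tensor_ext => v w; rewrite gE hE.
Qed.
End Tensor.

Section Bimodules.
Variables (F : fieldType) (k : nat) (d : 'I_k -> nat).
Local Notation S := (mxprod F d).

Record bimodule := Bimodule {
  bimod_car :> lmodType F;
  lact : S -> bimod_car -> bimod_car;
  ract : bimod_car -> S -> bimod_car;
  lact_linearl : forall m, linear (lact^~ m);
  lact_linearr : forall s, linear (lact s);
  ract_linearl : forall s, linear (ract^~ s);
  ract_linearr : forall m, linear (ract m);
  lact1 : forall m, lact 1 m = m;
  ract1 : forall m, ract m 1 = m;
  lactM : forall s t m, lact (s * t) m = lact s (lact t m);
  ractM : forall s t m, ract m (s * t) = ract (ract m s) t;
  lractA : forall s t m, ract (lact s m) t = lact s (ract m t)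
}.

Definition bimod_iso (M N : bimodule) : Prop :=
  exists f : {linear M -> N}, [/\ bijective f,
    forall s m, f (lact s m) = lact s (f m) &
    forall s m, f (ract m s) = ract (f m) s].

Section MatrixBimodule.
Variables i j : 'I_k.
Let M := 'M[F]_(d i, d j).

Definition mxbimod : bimodule.
Proof.
refine (@Bimodule M (fun s m => s i *m m) (fun m t => m *m t j)
  _ _ _ _ _ _ _ _ _).
- by move=> m c s t; rewrite dirsumDE dirsumZE mulmxDl scalemxAl.
- by move=> s c m n; rewrite linearP.
- by move=> s c m n; rewrite mulmxDl scalemxAl.
- by move=> m c s t; rewrite dirsumDE dirsumZE linearP.
- by move=> m; rewrite mxprod1E mul1mx.
- by move=> m; rewrite mxprod1E mulmx1.
- by move=> s t m; rewrite mxprodME mulmxA.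
- by move=> s t m; rewrite mxprodME mulmxA.
- by move=> s t m; rewrite mulmxA.
Defined.
End MatrixBimodule.

Section DirectSum.
Variables (I : finType) (M : I -> bimodule).

Definition dirsum_bimod : bimodule.
Proof.
refine (@Bimodule (dirsum M) (fun s m => [ffun i => lact s (m i)])
  (fun m t => [ffun i => ract (m i) t]) _ _ _ _ _ _ _ _ _).
- by move=> m c s t; apply/ffunP=> i; rewrite !ffunE lact_linearl.
- by move=> s c m n; apply/ffunP=> i; rewrite !ffunE lact_linearr.
- by move=> s c m n; apply/ffunP=> i; rewrite !ffunE ract_linearl.
- by move=> m c s t; apply/ffunP=> i; rewrite !ffunE ract_linearr.
- by move=> m; apply/ffunP=> i; rewrite !ffunE lact1.
- by move=> m; apply/ffunP=> i; rewrite !ffunE ract1.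
- by move=> s t m; apply/ffunP=> i; rewrite !ffunE lactM.
- by move=> s t m; apply/ffunP=> i; rewrite !ffunE ractM.
- by move=> s t m; apply/ffunP=> i; rewrite !ffunE lractA.
Defined.
End DirectSum.

Definition power_bimod (M : bimodule) (r : nat) : bimodule :=
  dirsum_bimod (fun _ : 'I_r => M).

Definition sum2_bimod (M N : bimodule) : bimodule.
Proof.
refine (@Bimodule (M * N)%type (fun s m => (lact s m.1, lact s m.2))
  (fun m t => (ract m.1 t, ract m.2 t)) _ _ _ _ _ _ _ _ _).
- by move=> m c s t; rewrite !lact_linearl.
- by move=> s c m n; rewrite !lact_linearr.
- by move=> s c m n; rewrite !ract_linearl.
- by move=> m c s t; rewrite !ract_linearr.
- by case=> m n; rewrite !lact1.
- by case=> m n; rewrite !ract1.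
- by move=> s t m; rewrite !lactM.
- by move=> s t m; rewrite !ractM.
- by move=> s t m; rewrite !lractA.
Defined.

End Bimodules.

Section DoubleDerivations.
Variables (F : fieldType) (k l : nat) (d : 'I_k -> nat) (e : 'I_l -> nat).
Local Notation S := (mxprod F d).
Local Notation T := (mxprod F e).
Local Notation SS := (tensor S S).
Implicit Types (s t u : S) (x : SS).

Definition outerl s : SS -> SS := tmap (lmul s) idfun.
Definition outerr t : SS -> SS := tmap idfun (rmul t).
Definition innerl s : SS -> SS := tmap idfun (lmul s).
Definition innerr t : SS -> SS := tmap (rmul t) idfun.

Lemma outerlE s t u : outerl s (tens t u) = tens (s * t) u.
Proof. exact: tmapE. Qed.
Lemma outerrE s t u : outerr s (tens t u) = tens t (u * s).
Proof. exact: tmapE. Qed.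
Lemma innerlE s t u : innerl s (tens t u) = tens t (s * u).
Proof. exact: tmapE. Qed.
Lemma innerrE s t u : innerr s (tens t u) = tens (t * s) u.
Proof. exact: tmapE. Qed.

HB.instance Definition _ s :=
  GRing.isLinear.Build F SS SS *:%R (outerl s) (tmap_linear _ _).
HB.instance Definition _ s :=
  GRing.isLinear.Build F SS SS *:%R (outerr s) (tmap_linear _ _).
HB.instance Definition _ s :=
  GRing.isLinear.Build F SS SS *:%R (innerl s) (tmap_linear _ _).
HB.instance Definition _ s :=
  GRing.isLinear.Build F SS SS *:%R (innerr s) (tmap_linear _ _).

Local Ltac by_tens f g :=
  apply: (tensor_ext (f := f) (g := g)) => a b /=;
  rewrite ?(outerlE, outerrE, innerlE, innerrE).

Lemma innerl_outerl s t x : innerl s (outerl t x) = outerl t (innerl s x).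
Proof. by by_tens (innerl s \o outerl t) (outerl t \o innerl s). Qed.
Lemma innerl_outerr s t x : innerl s (outerr t x) = outerr t (innerl s x).
Proof. by by_tens (innerl s \o outerr t) (outerr t \o innerl s); rewrite mulrA. Qed.
Lemma innerr_outerl s t x : innerr s (outerl t x) = outerl t (innerr s x).
Proof. by by_tens (innerr s \o outerl t) (outerl t \o innerr s); rewrite mulrA. Qed.
Lemma innerr_outerr s t x : innerr s (outerr t x) = outerr t (innerr s x).
Proof. by by_tens (innerr s \o outerr t) (outerr t \o innerr s). Qed.
Lemma innerl_innerr s t x : innerr t (innerl s x) = innerl s (innerr t x).
Proof. by by_tens (innerr t \o innerl s) (innerl s \o innerr t). Qed.
Lemma innerlM s t x : innerl (s * t) x = innerl s (innerl t x).
Proof. by by_tens (innerl (s * t)) (innerl s \o innerl t); rewrite mulrA. Qed.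
Lemma innerrM s t x : innerr (s * t) x = innerr t (innerr s x).
Proof. by by_tens (innerr (s * t)) (innerr t \o innerr s); rewrite mulrA. Qed.
Lemma innerl1 x : innerl 1 x = x.
Proof. by by_tens (innerl 1) (@idfun SS); rewrite mul1r. Qed.
Lemma innerr1 x : innerr 1 x = x.
Proof. by by_tens (innerr 1) (@idfun SS); rewrite mulr1. Qed.
Lemma innerl_linear c s t x : innerl (c *: s + t) x = c *: innerl s x + innerl t x.
Proof.
by_tens (innerl (c *: s + t)) (c \*: innerl s \+ innerl t).
by rewrite -tens_linearr; congr tens; apply: (rmul_linear b).
Qed.
Lemma innerr_linear c s t x : innerr (c *: s + t) x = c *: innerr s x + innerr t x.
Proof.
by_tens (innerr (c *: s + t)) (c \*: innerr s \+ innerr t).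
by rewrite -tens_linearl; congr tens; apply: (lmul_linear a).
Qed.

Definition is_double_der (D : 'Hom(S, SS)) : Prop :=
  forall s t, D (s * t) = outerl s (D t) + outerr t (D s).

(* iota is meant to be the inclusion of a unital subalgebra T of S. *)
Variable iota : T -> S.

Definition is_rel_double_der (D : 'Hom(S, SS)) : Prop :=
  is_double_der D /\ forall t : T, D (iota t) = 0.

Definition rel_double_der_pred : {pred 'Hom(S, SS)} :=
  fun D => `[< is_rel_double_der D >].

Record Der : Type := MkDer {
  der_val :> 'Hom(S, SS);
  der_valP : der_val \in rel_double_der_pred
}.

HB.instance Definition _ := [isSub for der_val].
HB.instance Definition _ := [Choice of Der by <:].

Fact rel_double_der_submod : submod_closed rel_double_der_pred.
Proof.
split=> [|c D E /asboolP[DD DT] /asboolP[ED ET]]; apply/asboolP.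
  by split=> [s t|t]; rewrite !lfunE /= ?linear0 ?addr0.
split=> [s t|t]; rewrite !(add_lfunE, scale_lfunE); last first.
  by rewrite DT ET scaler0 addr0.
by rewrite DD ED !linearP /= scalerDr addrACA.
Qed.

HB.instance Definition _ :=
  GRing.SubChoice_isSubLmodule.Build F _ _ Der rel_double_der_submod.

(* (s D t)(u) = D(u)' t \otimes s D(u)'' *)
Definition der_lact_fun s (D : 'Hom(S, SS)) : 'Hom(S, SS) :=
  linfun (innerl s \o D).
Definition der_ract_fun (D : 'Hom(S, SS)) t : 'Hom(S, SS) :=
  linfun (innerr t \o D).

Lemma der_lactE s D u : der_lact_fun s D u = innerl s (D u).
Proof. exact: lfunE. Qed.
Lemma der_ractE D t u : der_ract_fun D t u = innerr t (D u).
Proof. exact: lfunE. Qed.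

Fact der_lactP s (D : Der) : der_lact_fun s D \in rel_double_der_pred.
Proof.
have /asboolP[DD DT] := der_valP D; apply/asboolP; split=> [t u|t]; last first.
  by rewrite der_lactE /= DT linear0.
by rewrite !der_lactE /= DD linearD /= innerl_outerl innerl_outerr.
Qed.

Fact der_ractP (D : Der) s : der_ract_fun D s \in rel_double_der_pred.
Proof.
have /asboolP[DD DT] := der_valP D; apply/asboolP; split=> [t u|t]; last first.
  by rewrite der_ractE /= DT linear0.
by rewrite !der_ractE /= DD linearD /= innerr_outerl innerr_outerr.
Qed.

Definition der_lact s D : Der := MkDer (der_lactP s D).
Definition der_ract D t : Der := MkDer (der_ractP D t).

Lemma Der_ext (D E : Der) : (forall u, der_val D u = der_val E u) -> D = E.
Proof. by move=> DE; apply/val_inj/lfunP. Qed.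

Definition der_bimod : bimodule F d.
Proof.
refine (@Bimodule _ _ _ Der der_lact der_ract _ _ _ _ _ _ _ _ _).
- move=> D c s t; apply: Der_ext => u.
  by rewrite /= add_lfunE scale_lfunE !der_lactE innerl_linear.
- move=> s c D E; apply: Der_ext => u.
  by rewrite /= !(add_lfunE, scale_lfunE, der_lactE) linearP.
- move=> s c D E; apply: Der_ext => u.
  by rewrite /= !(add_lfunE, scale_lfunE, der_ractE) linearP.
- move=> D c s t; apply: Der_ext => u.
  by rewrite /= add_lfunE scale_lfunE !der_ractE innerr_linear.
- by move=> D; apply: Der_ext => u; rewrite der_lactE innerl1.
- by move=> D; apply: Der_ext => u; rewrite der_ractE innerr1.
- by move=> s t D; apply: Der_ext => u; rewrite !der_lactE innerlM.
- by move=> s t D; apply: Der_ext => u; rewrite !der_ractE innerrM.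
- by move=> s t D; apply: Der_ext => u; rewrite !(der_ractE, der_lactE) innerl_innerr.
Defined.
End DoubleDerivations.

(* The column space of the i-th block of S, restricted to T along iota, is the
   direct sum over j of a i j copies of the column space of the j-th block. *)
Definition is_bratteli (F : fieldType) (k l : nat) (d : 'I_k -> nat)
    (e : 'I_l -> nat) (iota : mxprod F e -> mxprod F d)
    (a : 'I_k -> 'I_l -> nat) : Prop :=
  forall i, exists f : {linear 'cV[F]_(d i) ->
      dirsum (fun p : {j : 'I_l & 'I_(a i j)} => 'cV[F]_(e (tag p)))},
    bijective f /\
    forall (t : mxprod F e) v p, f (iota t i *m v) p = t (tag p) *m f v p.

(* Main.v *)
From HB Require Import structures.
Require Import Defs.
From mathcomp Require Import all_boot all_order all_algebra.
From mathcomp Require Import boolp.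
Import GRing.Theory.
Set Implicit Arguments.
Unset Strict Implicit.
Unset Printing Implicit Defensive.
Local Open Scope ring_scope.

(** Write [V_i] for the column space of the [i]-th block of [S] and [e_i] for
    the matrix unit of that block at position (0, 0).

    By Morita theory for the semisimple algebra [S], a bimodule [M] is the
    direct sum over all pairs (i, j) of copies of the matrix bimodule
    [M_(d i, d j)], as many as the dimension of its corner [e_i M e_j]
    ([corner_decomposition]). So only the corners of the double derivations
    have to be computed.

    The inner bimodule structure multiplies the two tensor factors on their
    inner sides, hence [e_i D e_j] takes its values in [S e_j (x) e_i S].
    That space is [V_j (x) V_i^* = Hom(V_i, V_j)], on which the outer structure
    acts by matrix multiplication; [contract] and [insert] are the two
    directions of this identification. The corner is therefore the space of
    derivations [S -> Hom(V_i, V_j)] that vanish on [T].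

    Since [S] is separable, every such derivation is inner, of the form
    [s |-> s_j X - X s_i], and it vanishes on [T] exactly when [X : V_i -> V_j]
    is [T]-linear. The matrix [X] is determined up to [S]-linear maps
    [V_i -> V_j], which are the scalars if [i = j] and zero otherwise. The
    potential computed from the separability idempotent selects, in the
    diagonal case, the [X] whose (0, 0) entry vanishes, so that the corner is
    isomorphic to a space of matrices rather than to a quotient
    ([der_corner_basis]).

    Finally, [V_i] restricted to [T] is the sum of [a i u] copies of the [u]-th
    simple module, so Schur's lemma gives [\sum_u a i u * a j u] for the
    dimension of the space of [T]-linear maps ([intertwiner_space]), and the
    normalisation cuts out a hyperplane when [i = j]: the identity is
    [T]-linear and its (0, 0) entry is not zero. *)

(** * Linear maps and direct sums *)

Lemma linear_comb (R : pzRingType) (U V : lmodType R) (f : U -> V) (lf : linear f)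
    (I : finType) (c : I -> R) (x : I -> U) :
  f (\sum_i c i *: x i) = \sum_i c i *: f (x i).
Proof.
pose g : {linear U -> V} := HB.pack f (GRing.isLinear.Build R U V *:%R f lf).
by rewrite -[f]/(g : U -> V) linear_sum; apply: eq_bigr => i _; rewrite linearZ.
Qed.

Lemma linear_bigsum (R : pzRingType) (U V : lmodType R) (f : U -> V) (lf : linear f)
    (I : finType) (x : I -> U) :
  f (\sum_i x i) = \sum_i f (x i).
Proof.
have := linear_comb lf (fun _ => 1) x.
by under eq_bigr do rewrite scale1r; under [RHS]eq_bigr do rewrite scale1r.
Qed.

Lemma linear_scale (R : pzRingType) (U V : lmodType R) (f : U -> V) (lf : linear f) c x :
  f (c *: x) = c *: f x.
Proof.
pose g : {linear U -> V} := HB.pack f (GRing.isLinear.Build R U V *:%R f lf).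
by rewrite -[f]/(g : U -> V) linearZ.
Qed.

Lemma dirsum_ext (I : finType) (V : I -> Type) (x y : dirsum V) :
  (forall i, x i = y i) -> x = y.
Proof. by move=> xy; apply/ffunP. Qed.

Lemma dirsum_sumE (I J : finType) (V : I -> zmodType) (P : pred J)
    (x : J -> dirsum V) i :
  (\sum_(j | P j) x j) i = \sum_(j | P j) x j i.
Proof.
by elim/big_rec2: _ => [|j _ y _ <-]; rewrite ?dirsum0E ?dirsumDE.
Qed.

Lemma sum_tagged (V : nmodType) (I : finType) (J : I -> finType)
    (G : {i : I & J i} -> V) :
  \sum_p G p = \sum_i \sum_(c : J i) G (Tagged J c).
Proof.
rewrite (@sig_big_dep _ _ _ _ _ xpredT (fun _ => xpredT) (fun i c => G (Tagged J c))).
by apply: eq_bigr => -[i c].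
Qed.

Lemma mulmx_ext (F : fieldType) m n (A B : 'M[F]_(m, n)) :
  (forall v : 'cV_n, A *m v = B *m v) -> A = B.
Proof.
move=> AB; apply: trmx_inj; apply/row_matrixP=> i.
by apply: trmx_inj; rewrite !tr_row !trmxK !colE.
Qed.

(** The witness [x] makes [phi] a nonzero functional on [U], so its image is a
    line. *)
Lemma hyperplane_dim (F : fieldType) (V : vectType F) (U : {vspace V})
    (phi : {linear V -> F^o}) (x : V) : x \in U -> phi x != 0 ->
  \dim (U :&: lker (linfun phi)) = (\dim U - 1)%N.
Proof.
move=> xU phix; rewrite -(limg_ker_dim (linfun phi) U).
suff -> : \dim (linfun phi @: U) = 1%N by rewrite addnK.
apply/eqP; rewrite eqn_leq; apply/andP; split.
  by rewrite (leq_trans (dimvS (subvf _))) // dimvf.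
rewrite lt0n dimv_eq0; apply: contraNneq phix => im0.
by have := memv_img (linfun phi) xU; rewrite im0 memv0 lfunE.
Qed.

(** * Matrix units *)

Section MatrixUnits.
Variables (F : fieldType) (k : nat) (d : 'I_k -> nat).
Local Notation S := (mxprod F d).
Implicit Types s : S.

(** The positions are compared as numbers, which avoids transporting [x] and [y]
    to the size of block [j]. *)
Definition munit i (x y : 'I_(d i)) : S :=
  [ffun j => \matrix_(v, w) [&& j == i, v == x :> nat & w == y :> nat]%:R].

Lemma munitE i (x y : 'I_(d i)) : munit x y i = delta_mx x y.
Proof. by apply/matrixP=> v w; rewrite ffunE !mxE eqxx. Qed.

Lemma munit_neq i j (x y : 'I_(d i)) : j != i -> munit x y j = 0.
Proof. by move=> /negPf ne; apply/matrixP=> v w; rewrite ffunE !mxE ne. Qed.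

Lemma munitM i (x y y' z : 'I_(d i)) :
  munit x y * munit y' z = (y == y')%:R *: munit x z.
Proof.
apply/ffunP=> j; rewrite mxprodME dirsumZE.
have [->|ne] := eqVneq j i; last by rewrite !munit_neq // mul0mx scaler0.
rewrite !munitE; have [<-|ne] := eqVneq y y'.
  by rewrite mul_delta_mx scale1r.
by rewrite mul_delta_mx_0 // scale0r.
Qed.

Lemma munitM_neq i j (x y : 'I_(d i)) (z w : 'I_(d j)) :
  i != j -> munit x y * munit z w = 0.
Proof.
move=> ne; apply/ffunP=> h; rewrite mxprodME dirsum0E.
have [->|neh] := eqVneq h i; last by rewrite munit_neq // mul0mx.
by rewrite (munit_neq z w ne) mulmx0.
Qed.

Lemma mul_munit s i (x y : 'I_(d i)) :
  s * munit x y = \sum_v s i v x *: munit v y.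
Proof.
apply/ffunP=> j; rewrite mxprodME dirsum_sumE.
have [->|ne] := eqVneq j i; last first.
  by rewrite munit_neq // mulmx0 big1 // => v _; rewrite dirsumZE munit_neq ?scaler0.
apply/matrixP=> v w; rewrite munitE !mxE summxE (bigD1 x) //= [RHS](bigD1 v) //=.
rewrite dirsumZE munitE !mxE !eqxx /= big1 => [|z /negPf ne]; last by rewrite !mxE ne mulr0.
by rewrite big1 // => z ne; rewrite dirsumZE munitE !mxE [v == z]eq_sym (negPf ne) mulr0.
Qed.

Lemma munit_mul s i (x y : 'I_(d i)) :
  munit x y * s = \sum_v s i y v *: munit x v.
Proof.
apply/ffunP=> j; rewrite mxprodME dirsum_sumE.
have [->|ne] := eqVneq j i; last first.
  by rewrite munit_neq // mul0mx big1 // => v _; rewrite dirsumZE munit_neq ?scaler0.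
apply/matrixP=> v w; rewrite munitE !mxE summxE (bigD1 y) //= [RHS](bigD1 w) //=.
rewrite dirsumZE munitE !mxE !eqxx /= andbT big1 => [|z /negPf ne]; last first.
  by rewrite !mxE ne andbF mul0r.
rewrite big1 ?addr0 1?mulrC // => z /negPf ne.
by rewrite dirsumZE munitE !mxE [w == z]eq_sym ne andbF mulr0.
Qed.

Lemma sum_munit : 1 = \sum_i \sum_(x < d i) munit x x :> S.
Proof.
apply/ffunP=> j; rewrite mxprod1E dirsum_sumE (bigD1 j) //= dirsum_sumE.
rewrite (eq_bigr (fun x => delta_mx x x)) => [|x _]; last exact: munitE.
rewrite -mx1_sum_delta big1 ?addr0 // => i ne; rewrite dirsum_sumE big1 // => x _.
by rewrite munit_neq // eq_sym.
Qed.
End MatrixUnits.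

(** * Bimodules are determined by their corners *)

Section Corners.
Variables (F : fieldType) (k : nat) (d : 'I_k -> nat).
Hypothesis d_gt0 : forall i, (0 < d i)%N.
Local Notation S := (mxprod F d).

Definition org i : 'I_(d i) := Ordinal (d_gt0 i).
Definition corner_idem i : S := munit F (org i) (org i).

(** The corner [e_i M e_j] has basis [n]. The coordinate functionals [c] live on
    all of [M], through the projection [x |-> e_i x e_j], so that the corner need
    not be made into a type of its own. *)
Definition corner_basis (M : bimodule F d) i j m :=
  exists (n : 'I_m -> M) (c : 'I_m -> {linear M -> F^o}),
    (forall q q', c q (n q') = (q == q')%:R) /\
    forall x, \sum_q c q x *: n q = lact (corner_idem i) (ract x (corner_idem j)).

Lemma lact0 (M : bimodule F d) (s : S) : lact s (0 : M) = 0.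
Proof. by have := linear_scale (lact_linearr s) 0 (0 : M); rewrite !scale0r. Qed.
Lemma lact0l (M : bimodule F d) (m : M) : lact 0 m = 0.
Proof. by have := linear_scale (lact_linearl m) 0 0; rewrite !scale0r. Qed.
Lemma ract0r (M : bimodule F d) (m : M) : ract m 0 = 0.
Proof. by have := linear_scale (ract_linearr m) 0 0; rewrite !scale0r. Qed.

(** Both unit actions are expanded along the decomposition of 1 into diagonal
    matrix units. *)
Lemma munit_decomposition (M : bimodule F d) (m : M) :
  m = \sum_(p : 'I_k * 'I_k) \sum_(x < d p.1) \sum_(y < d p.2)
        lact (munit F x x) (ract m (munit F y y)).
Proof.
rewrite -{1}[m]lact1 -{1}[m]ract1 {1}sum_munit (linear_bigsum (lact_linearl _)).
rewrite -(pair_bigA _ (fun i j => \sum_(x < d i) \sum_(y < d j)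
  lact (munit F x x) (ract m (munit F y y)))) /=.
apply: eq_bigr => i _; rewrite (linear_bigsum (lact_linearl _)) exchange_big /=.
apply: eq_bigr => x _; rewrite {1}sum_munit (linear_bigsum (ract_linearr _)).
rewrite (linear_bigsum (lact_linearr _)); apply: eq_bigr => j _.
by rewrite (linear_bigsum (ract_linearr _)) (linear_bigsum (lact_linearr _)).
Qed.

(** Matrix units carry every block [E_vv m E_ww] of an element [m] into the corner
    [e_i M e_j] and back: the entry (v, w) of the [q]-th matrix attached to [m] is
    the [q]-th coordinate of [E_0v m E_w0], and [m] is recovered as the sum of
    the [E_v0 n_q E_0w] weighted by these entries. *)
Theorem corner_decomposition (M : bimodule F d) (m : 'I_k * 'I_k -> nat) :
  (forall p, corner_basis M p.1 p.2 (m p)) ->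
  bimod_iso M (dirsum_bimod (fun p => power_bimod (mxbimod F d p.1 p.2) (m p))).
Proof.
move=> H; pose n p := sval (cid (H p)).
pose c p := sval (cid (svalP (cid (H p)))).
have cn p q q' : c p q (n p q') = (q == q')%:R.
  by rewrite /c /n; case: (svalP (cid (svalP (cid (H p))))).
have nc p x : \sum_q c p q x *: n p q
            = lact (corner_idem p.1) (ract x (corner_idem p.2)).
  by rewrite /c /n; case: (svalP (cid (svalP (cid (H p))))).
have nE p q : lact (corner_idem p.1) (ract (n p q) (corner_idem p.2)) = n p q.
  rewrite -nc (bigD1 q) //= cn eqxx scale1r big1 ?addr0 // => q' ne.
  by rewrite cn (negPf ne) scale0r.
pose N := dirsum_bimod (fun p => power_bimod (mxbimod F d p.1 p.2) (m p)).
pose f (x : M) : N := [ffun p => [ffun q => \matrix_(v, w)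
  c p q (lact (munit F (org p.1) v) (ract x (munit F w (org p.2))))]].
have fl : linear f.
  move=> a x y; refine (dirsum_ext _) => p; refine (dirsum_ext _) => q.
  apply/matrixP=> v w.
  by rewrite !ffunE !mxE ract_linearl lact_linearr linearP.
pose g (z : N) : M := \sum_p \sum_q \sum_v \sum_w
  z p q v w *: lact (munit F v (org p.1)) (ract (n p q) (munit F (org p.2) w)).
have fE x p q v w : f x p q v w
    = c p q (lact (munit F (org p.1) v) (ract x (munit F w (org p.2)))).
  by rewrite !ffunE mxE.
pose fL : {linear M -> N} := HB.pack f (GRing.isLinear.Build F M N *:%R f fl).
exists fL; split.
- exists g => [x|z].
    rewrite [RHS]munit_decomposition /= /g; apply: eq_bigr => p _.
    rewrite exchange_big; apply: eq_bigr => v _ /=.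
    rewrite exchange_big; apply: eq_bigr => w _ /=.
    under eq_bigr do rewrite fE.
    rewrite -(linear_comb (lact_linearr _)) -(linear_comb (ract_linearl _)) nc.
    by rewrite !lractA -!lactM -!ractM !(munitM, eqxx, scale1r).
  refine (dirsum_ext _) => p; refine (dirsum_ext _) => q; apply/matrixP=> v w.
  rewrite fE.
  pose h x : F := c p q (lact (munit F (org p.1) v) (ract x (munit F w (org p.2)))).
  have hl : linear (h : M -> F^o).
    by move=> a x y; rewrite /h ract_linearl lact_linearr linearP.
  (* Of the four sums in [g z], only the term with the indices of the
     coordinate [h] survives; a different pair of blocks is killed by the
     product of matrix units on the side where the blocks differ. *)
  rewrite -[LHS]/(h (g z)) (linear_bigsum hl) (bigD1 p) //= [X in _ + X]big1; last first.
    move=> p' ne; rewrite (linear_bigsum hl) big1 // => q' _.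
    rewrite (linear_bigsum hl) big1 // => v' _.
    rewrite (linear_comb hl) big1 // => w' _.
    rewrite /h !lractA -!lactM -!ractM.
    have : (p.1 != p'.1) || (p.2 != p'.2).
      by rewrite -negb_and -xpair_eqE -!surjective_pairing eq_sym.
    case/orP=> ne'.
      by rewrite munitM_neq // lact0l linear0 scaler0.
    by rewrite (@munitM_neq _ _ _ p'.2 p.2) 1?eq_sym // ract0r lact0 linear0 scaler0.
  have hE q' v' w' : h (lact (munit F v' (org p.1)) (ract (n p q') (munit F (org p.2) w')))
      = (v == v')%:R * ((w' == w)%:R * (q == q')%:R).
    rewrite /h !lractA -!lactM -!ractM !munitM.
    rewrite (linear_scale (lact_linearl _)) (linear_scale (ract_linearr _)).
    by rewrite (linear_scale (lact_linearr _)) !linearZ /= nE cn.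
  rewrite addr0 (linear_bigsum hl) (bigD1 q) //= [X in _ + X]big1 ?addr0; last first.
    move=> q' ne; rewrite (linear_bigsum hl) big1 // => v' _.
    rewrite (linear_comb hl) big1 // => w' _.
    by rewrite hE [q == q']eq_sym (negPf ne) !mulr0 scaler0.
  rewrite (linear_bigsum hl) (bigD1 v) //= [X in _ + X]big1 ?addr0; last first.
    move=> v' ne; rewrite (linear_comb hl) big1 // => w' _.
    by rewrite hE [v == v']eq_sym (negPf ne) !mul0r scaler0.
  rewrite (linear_comb hl) (bigD1 w) //= [X in _ + X]big1 ?addr0; last first.
    by move=> w' ne; rewrite hE (negPf ne) !(mul0r, mulr0) scaler0.
  by rewrite hE !eqxx !mulr1 /GRing.scale /= mulr1.
- move=> s x; refine (dirsum_ext _) => p; refine (dirsum_ext _) => q.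
  apply/matrixP=> v w.
  transitivity (\sum_v' s p.1 v v' * f x p q v' w); last first.
    rewrite [lact s _]/lact /= !ffunE [RHS]mxE.
    by apply: eq_bigr => v' _; rewrite !mxE.
  rewrite [LHS]fE lractA -lactM munit_mul (linear_comb (lact_linearl _)) linear_sum.
  by apply: eq_bigr => v' _; rewrite linearZ fE.
- move=> s x; refine (dirsum_ext _) => p; refine (dirsum_ext _) => q.
  apply/matrixP=> v w.
  transitivity (\sum_w' f x p q v w' * s p.2 w' w); last first.
    rewrite [ract _ s]/ract /= !ffunE [RHS]mxE.
    by apply: eq_bigr => w' _; rewrite !mxE.
  rewrite [LHS]fE -ractM mul_munit (linear_comb (ract_linearr _)).
  rewrite (linear_comb (lact_linearr _)) linear_sum.
  by apply: eq_bigr => v' _; rewrite linearZ fE mulrC.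
Qed.

Lemma bimod_iso_trans (M N P : bimodule F d) :
  bimod_iso M N -> bimod_iso N P -> bimod_iso M P.
Proof.
move=> [f [fb fl fr]] [g [gb gl gr]]; exists (g \o f : {linear M -> P}).
split=> [|s m|s m] /=; first exact: bij_comp.
- by rewrite fl gl.
- by rewrite fr gr.
Qed.

Lemma dirsum_split_diag (B : 'I_k * 'I_k -> bimodule F d) :
  bimod_iso (dirsum_bimod B)
    (sum2_bimod (dirsum_bimod (fun i => B (i, i)))
       (dirsum_bimod (fun p : {p : 'I_k * 'I_k | p.1 != p.2} => B (val p)))).
Proof.
pose M := dirsum_bimod B.
pose D := dirsum_bimod (fun i => B (i, i)).
pose O := dirsum_bimod (fun p : {p : 'I_k * 'I_k | p.1 != p.2} => B (val p)).
pose f (x : M) : sum2_bimod D O := ([ffun i => x (i, i)], [ffun p => x (val p)]).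
have fl : linear f.
  move=> a x y; rewrite [LHS]/f [RHS]surjective_pairing; congr (_, _).
    rewrite -[RHS]/(a *: (f x).1 + (f y).1); refine (dirsum_ext _) => p.
    by rewrite !(ffunE, dirsumDE, dirsumZE).
  rewrite -[RHS]/(a *: (f x).2 + (f y).2); refine (dirsum_ext _) => p.
  by rewrite !(ffunE, dirsumDE, dirsumZE).
(* On the diagonal, the component of index (i, i) has to be seen in the type
   indexed by (i, j) when [i == j] is known; hence the transport. *)
pose diag (y : D) (p : 'I_k * 'I_k) : p.1 == p.2 -> B p :=
  let: (i, j) := p in fun ij => eq_rect i (fun j => B (i, j)) (y i) j (eqP ij).
pose g (z : sum2_bimod D O) : M := [ffun p =>
  match decP (@idP (p.1 != p.2)) with
  | left ne => z.2 (Sub p ne)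
  | right eq => diag z.1 p (negbNE (introN idP eq))
  end].
pose fL : {linear M -> sum2_bimod D O} :=
  HB.pack f (GRing.isLinear.Build F M (sum2_bimod D O) *:%R f fl).
have diagE (y : D) i (ii : i == i) : diag y (i, i) ii = y i.
  by rewrite /diag; move: (eqP ii) => e; rewrite (eq_irrelevance e erefl).
exists fL; split.
- exists g => [x|[y z]].
    refine (dirsum_ext _) => -[i j]; rewrite ffunE.
    case: (decP _) => [ne|eq]; first by rewrite ffunE.
    have ij := eqP (negbNE (introN idP eq)); rewrite /= in ij; case: _ / ij eq => eq.
    by rewrite diagE ffunE.
  congr (_, _); refine (dirsum_ext _) => p; rewrite ffunE ffunE.
    case: (decP _) => [ne|eq]; last by rewrite diagE.
    by case/eqP: ne.
  case: (decP _) => [ne|eq]; last by case: eq; exact: (valP p).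
  by case: p ne => p np ne; rewrite (bool_irrelevance ne np).
- by move=> s x; congr (_, _); refine (dirsum_ext _) => p; rewrite !ffunE.
- by move=> s x; congr (_, _); refine (dirsum_ext _) => p; rewrite !ffunE.
Qed.
End Corners.

(** * Corners of the tensor square and derivations into them *)

Section TensorLift.
Variables (F : fieldType) (V W : vectType F) (U : lmodType F) (b : V -> W -> U).
Hypotheses (bl : forall w, linear (b^~ w)) (br : forall v, linear (b v)).

Definition tensor_lift : {linear tensor V W -> U} :=
  s2val (cid2 (tensor_universal bl br)).

Lemma tensor_liftE v w : tensor_lift (tens v w) = b v w.
Proof. exact: (s2valP (cid2 (tensor_universal bl br))). Qed.
End TensorLift.

Section CornerTensors.
Variables (F : fieldType) (k : nat) (d : 'I_k -> nat).
Hypothesis d_gt0 : forall i, (0 < d i)%N.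
Local Notation S := (mxprod F d).
Local Notation SS := (tensor S S).
Local Notation org := (org d_gt0).
Variables i j : 'I_k.

(** The element [s e_j (x) e_i t] is determined by column 0 of [s_j] and row 0 of
    [t_i]; their product is the corresponding element of [Hom(V_i, V_j)]. *)
Definition corner_pairing (s t : S) : 'M[F]_(d j, d i) :=
  col (org j) (s j) *m row (org i) (t i).

Lemma corner_pairing_linearl t : linear (corner_pairing^~ t).
Proof.
by move=> c x y; rewrite /corner_pairing dirsumDE dirsumZE !linearP mulmxDl scalemxAl.
Qed.

Lemma corner_pairing_linearr s : linear (corner_pairing s).
Proof. by move=> c x y; rewrite /corner_pairing dirsumDE dirsumZE !linearP. Qed.

Definition contract : {linear SS -> 'M[F]_(d j, d i)} :=
  tensor_lift corner_pairing_linearl corner_pairing_linearr.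

Lemma contractE s t : contract (tens s t) = corner_pairing s t.
Proof. exact: tensor_liftE. Qed.

Definition insert (X : 'M[F]_(d j, d i)) : SS :=
  \sum_v \sum_w X v w *: tens (munit F v (org j)) (munit F (org i) w).

Fact insert_linear : linear insert.
Proof.
move=> c X Y; rewrite /insert scaler_sumr -big_split; apply: eq_bigr => v _.
rewrite scaler_sumr -big_split; apply: eq_bigr => w _.
by rewrite !mxE scalerDl scalerA.
Qed.
HB.instance Definition _ := GRing.isLinear.Build F _ _ *:%R insert insert_linear.

Lemma insertK X : contract (insert X) = X.
Proof.
rewrite /insert linear_sum {2}(matrix_sum_delta X); apply: eq_bigr => v _.
rewrite linear_sum; apply: eq_bigr => w _; rewrite linearZ contractE.
rewrite /corner_pairing !munitE; congr (_ *: _); apply/matrixP=> x y.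
by rewrite !mxE big_ord1 !mxE !eqxx andbT /= -natrM mulnb.
Qed.

(** On [s (x) t], both sides are [s e_j (x) e_i t]. *)
Lemma insert_contract x :
  insert (contract x) = innerl (corner_idem F d_gt0 i) (innerr (corner_idem F d_gt0 j) x).
Proof.
apply: (tensor_ext (f := insert \o contract)
  (g := innerl (corner_idem F d_gt0 i) \o innerr (corner_idem F d_gt0 j))) => s t /=.
rewrite contractE innerrE innerlE /corner_idem mul_munit munit_mul.
rewrite (linear_comb (tens_linearl _)); apply: eq_bigr => v _.
rewrite (linear_comb (tens_linearr _)) scaler_sumr; apply: eq_bigr => w _.
by rewrite scalerA !mxE big_ord1 !mxE.
Qed.

Lemma contract_outerl s x : contract (outerl s x) = s j *m contract x.
Proof.
apply: (tensor_ext (f := contract \o outerl s) (g := mulmx (s j) \o contract)) => t u /=.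
by rewrite outerlE !contractE /corner_pairing mxprodME !colE !mulmxA.
Qed.

Lemma contract_outerr s x : contract (outerr s x) = contract x *m s i.
Proof.
apply: (tensor_ext (f := contract \o outerr s) (g := mulmxr (s i) \o contract)) => t u /=.
by rewrite outerrE !contractE /corner_pairing mxprodME row_mul mulmxA.
Qed.

Lemma insert_corner X :
  innerl (corner_idem F d_gt0 i) (innerr (corner_idem F d_gt0 j) (insert X)) = insert X.
Proof. by rewrite -insert_contract insertK. Qed.

(** The outer actions commute with the projection to the corner, so [insert]
    inherits the equivariance of [contract]. *)
Lemma insert_outerl (s : S) X : insert (s j *m X) = outerl s (insert X).
Proof.
rewrite -{1}[X]insertK -contract_outerl insert_contract.
by rewrite innerr_outerl innerl_outerl insert_corner.
Qed.

Lemma insert_outerr (s : S) X : insert (X *m s i) = outerr s (insert X).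
Proof.
rewrite -{1}[X]insertK -contract_outerr insert_contract.
by rewrite innerr_outerr innerl_outerr insert_corner.
Qed.

Definition inner_der (X : 'M[F]_(d j, d i)) (s : S) := s j *m X - X *m s i.

Lemma inner_derM X (s t : S) :
  inner_der X (s * t) = s j *m inner_der X t + inner_der X s *m t i.
Proof.
by rewrite /inner_der !mxprodME mulmxBr mulmxBl !mulmxA addrA subrK.
Qed.

(** The element [\sum_v E_v0 (x) E_0v] of [S (x) S] commutes with [S] in
    block [i] and its product is the unit of that block. Applying [D] to its left
    factor gives the potential, as in the proof that separable algebras have only
    inner derivations. *)
Definition potential (D : S -> 'M[F]_(d j, d i)) : 'M[F]_(d j, d i) :=
  - \sum_v D (munit F v (org i)) *m delta_mx (org i) v.

(** Expanding [D (s E_v0)] by the derivation rule gives [s_j] times minus the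
    potential, plus [D s] times the unit of block [i]; expanding [s E_v0] in matrix
    units first gives minus the potential times [s_i]. *)
Lemma inner_der_potential (D : S -> 'M[F]_(d j, d i)) : linear D ->
  (forall s t, D (s * t) = s j *m D t + D s *m t i) ->
  inner_der (potential D) =1 D.
Proof.
move=> Dl DM s; rewrite /inner_der /potential mulmxN mulNmx opprK addrC.
apply/eqP; rewrite subr_eq; apply/eqP.
transitivity (\sum_v (s j *m D (munit F v (org i)) + D s *m (munit F v (org i)) i)
   *m delta_mx (org i) v); last first.
  rewrite mulmx_sumr; under eq_bigr do rewrite mulmxDl munitE -!mulmxA.
  rewrite big_split /= addrC; congr (_ + _).
  under eq_bigr do rewrite mul_delta_mx.
  by rewrite -mulmx_sumr -mx1_sum_delta mulmx1.
rewrite mulmx_suml.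
under [RHS]eq_bigr do rewrite -DM mul_munit (linear_comb Dl) mulmx_suml.
rewrite exchange_big /=; apply: eq_bigr => w _.
under [RHS]eq_bigr do rewrite -scalemxAl scalemxAr.
rewrite -mulmx_sumr -mulmxA; congr (_ *m _); apply/matrixP=> x y.
rewrite !mxE summxE (bigD1 w) //= !mxE eqxx andbT.
rewrite [X in _ = X](bigD1 y) //= !mxE eqxx andbT big1 => [|z ne]; last first.
  by rewrite !mxE (negPf ne) andbF mul0r.
rewrite big1 => [|z /negPf ne]; last by rewrite !mxE [y == z]eq_sym ne andbF mulr0.
by rewrite mulrC.
Qed.

(** The potential of an inner derivation differs from [X] by
    [\sum_v E_v0 X E_0v]. This is zero if the blocks differ, and the (0, 0) entry
    of [X] times the identity otherwise. *)
Lemma potential_inner_der (X : 'M[F]_(d j, d i)) : (i == j -> X (org j) (org i) = 0) ->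
  potential (inner_der X) = X.
Proof.
move=> X0; rewrite /potential /inner_der.
under eq_bigr do rewrite mulmxBl munitE -!mulmxA mul_delta_mx.
rewrite sumrB -mulmx_sumr -mx1_sum_delta mulmx1 opprB big1 ?subr0 // => v _.
apply/matrixP=> x y; rewrite mulmxA !mxE big1 // => w _; rewrite !mxE.
have [->|ne] := eqVneq w (org i); last by rewrite mulr0.
rewrite big1 ?mul0r // => z _; rewrite ffunE !mxE.
have [ji|] := eqVneq j i; last by rewrite mul0r.
have [z0|] := eqVneq (z : nat) (org i); last by rewrite !andbF mul0r.
by rewrite (_ : z = org j) ?X0 ?mulr0 ?ji //; apply: val_inj.
Qed.

(** The entry in question is, up to sign, the (0, 0) entry of [D e] for the
    idempotent [e = E_00], and [D e = e D e + D e e] counts this entry twice on the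
    right. *)
Lemma potential_org (D : S -> 'M[F]_(d j, d i)) :
  (forall s t, D (s * t) = s j *m D t + D s *m t i) ->
  i == j -> potential D (org j) (org i) = 0.
Proof.
move=> DM ij; rewrite /potential mxE summxE (bigD1 (org i)) //= big1 => [|v ne]; last first.
  by rewrite mxE big1 // => w _; rewrite !mxE [org i == v]eq_sym (negPf ne) andbF mulr0.
set e := munit F (org i) (org i).
have De : D e = e j *m D e + D e *m delta_mx (org i) (org i).
  by rewrite -{1}[e]scale1r -{1}[1]/((true)%:R) -(eqxx (org i)) -munitM DM munitE.
have {De} := congr1
  (fun Y : 'M_(d j, d i) => Y (org j) (org i)) De; rewrite [RHS]mxE.
have -> : (e j *m D e) (org j) (org i) = D e (org j) (org i).
  rewrite mxE (bigD1 (org j)) //= big1 => [|z ne]; last first.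
    rewrite ffunE !mxE (_ : _ && _ = false) ?mul0r //.
    by apply/negbTE; apply: contra ne => /and3P[_ _ z0]; rewrite -val_eqE.
  by rewrite ffunE !mxE eq_sym ij !eqxx mul1r addr0.
rewrite !mxE addr0 => /eqP; rewrite -[X in X == _]addr0 (inj_eq (addrI _)).
by move=> /eqP <-; rewrite oppr0.
Qed.
End CornerTensors.

(** * Corners of the double derivations *)

Section DerCorner.
Variables (F : fieldType) (k l : nat) (d : 'I_k -> nat) (e : 'I_l -> nat).
Hypothesis d_gt0 : forall i, (0 < d i)%N.
Variable iota : mxprod F e -> mxprod F d.
Local Notation S := (mxprod F d).
Local Notation org := (org d_gt0).

Definition intertwines i j (X : 'M[F]_(d j, d i)) :=
  forall t, iota t j *m X = X *m iota t i.

Lemma inner_der_linear i j (X : 'M[F]_(d j, d i)) : linear (inner_der X).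
Proof.
move=> c s t; rewrite /inner_der !dirsumDE !dirsumZE !mulmxDl linearP -!scalemxAl.
by rewrite /= scalerBr !opprD addrACA linearZ.
Qed.

Lemma inner_der_linearl i j (s : S) : linear (fun X : 'M[F]_(d j, d i) => inner_der X s).
Proof.
move=> c X Y; rewrite /inner_der mulmxDr mulmxDl -scalemxAl -scalemxAr.
by rewrite scalerBr opprD addrACA.
Qed.

Lemma potential_contract_linear (i j : 'I_k) : linear (fun D : 'Hom(S, tensor S S) =>
  potential d_gt0 (fun s => contract F d_gt0 i j (D s))).
Proof.
move=> c D E; rewrite /potential scalerN scaler_sumr -opprD -big_split; congr (- _).
apply: eq_bigr => v _; rewrite add_lfunE scale_lfunE linearP /=.
by rewrite mulmxDl scalemxAl.
Qed.

(** The correspondence between double derivations and potentials is linear in both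
    directions, so a basis of the space [W] of normalised potentials yields the
    basis of the corner, and the coordinates of the potential yield the
    functionals. *)
Lemma der_corner_basis i j (W : {vspace 'M[F]_(d j, d i)}) :
  (forall X, X \in W <-> intertwines X /\ (i == j -> X (org j) (org i) = 0)) ->
  corner_basis d_gt0 (der_bimod iota) i j (\dim W).
Proof.
move=> WP.
pose insder (X : 'M[F]_(d j, d i)) : 'Hom(S, tensor S S) :=
  linfun (fun s => insert d_gt0 (inner_der X s)).
have insderE X s : insder X s = insert d_gt0 (inner_der X s).
  have fl : linear (fun s => insert d_gt0 (inner_der X s)).
    by move=> c x y; rewrite inner_der_linear linearP.
  pose f : {linear S -> tensor S S} := HB.pack (fun s => insert d_gt0 (inner_der X s))
    (GRing.isLinear.Build F S (tensor S S) *:%R _ fl).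
  exact: (lfunE f).
have insderP X : X \in W -> insder X \in rel_double_der_pred iota.
  move=> /WP [XT _]; apply/asboolP; split=> [s t|t]; rewrite !insderE.
    by rewrite inner_derM linearD /= insert_outerl insert_outerr.
  by rewrite /inner_der XT subrr linear0.
have basW q : (vbasis W)`_q \in W.
  have [lt|ge] := ltnP q (size (vbasis W)); first by rewrite vbasis_mem ?mem_nth.
  by rewrite nth_default ?mem0v.
pose n (q : 'I_(\dim W)) : Der iota := MkDer (insderP _ (basW q)).
pose pot (D : Der iota) := potential d_gt0 (fun s => contract F d_gt0 i j (D s)).
pose c (q : 'I_(\dim W)) (D : Der iota) : F^o := coord (vbasis W) q (pot D).
have cl q : linear (c q).
  by move=> a D E; rewrite /c /pot potential_contract_linear linearP.
pose cL q : {linear der_bimod iota -> F^o} :=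
  HB.pack (c q) (GRing.isLinear.Build F (Der iota) F^o *:%R (c q) (cl q)).
have derM (D : Der iota) s t : contract F d_gt0 i j (D (s * t))
    = s j *m contract F d_gt0 i j (D t) + contract F d_gt0 i j (D s) *m t i.
  have /asboolP[DD _] := der_valP D.
  by rewrite DD linearD contract_outerl contract_outerr.
have adpot (D : Der iota) s : inner_der (pot D) s = contract F d_gt0 i j (D s).
  rewrite inner_der_potential //.
  by move=> a x y; rewrite !linearP.
have potW D : pot D \in W.
  apply/WP; split; last exact: potential_org.
  move=> t; apply/eqP; rewrite -subr_eq0; apply/eqP.
  have /asboolP[_ DT] := der_valP D.
  by rewrite -[LHS]/(inner_der (pot D) (iota t)) adpot DT linear0.
have potK X : X \in W ->
    potential d_gt0 (fun s => contract F d_gt0 i j (insder X s)) = X.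
  move=> /WP [_ X0].
  rewrite (_ : (fun s => _) = inner_der X) ?potential_inner_der //.
  by apply/funext=> s; rewrite insderE insertK.
exists n, cL; split=> [q q'|D].
  by rewrite /= /c /pot /= potK // coord_free ?(basis_free (vbasisP W)) // eq_sym.
apply: Der_ext => s.
rewrite [RHS]der_lactE /= der_ractE -insert_contract -adpot.
rewrite (coord_vbasis (potW D)) (linear_comb (inner_der_linearl s)).
rewrite (linear_comb (@insert_linear _ _ _ d_gt0 i j)).
pose ev (E : Der iota) := der_val E s.
have evl : linear ev by move=> a E G; rewrite /ev add_lfunE scale_lfunE.
rewrite -[LHS]/(ev _) (linear_comb evl); apply: eq_bigr => q _.
by rewrite /ev /= insderE.
Qed.
End DerCorner.

(** * Intertwiners of a subalgebra *)

Section Schur.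
Variables (F : fieldType) (l : nat) (e : 'I_l -> nat).
Hypothesis e_gt0 : forall u, (0 < e u)%N.
Local Notation T := (mxprod F e).
Local Notation org := (org e_gt0).

(** The [T]-module containing the [u]-th simple module [m u] times. *)
Definition mult_module (m : 'I_l -> nat) :=
  dirsum (fun p : {u : 'I_l & 'I_(m u)} => 'cV[F]_(e (tag p))).

Definition mult_act (m : 'I_l -> nat) (t : T) (w : mult_module m) :
    mult_module m :=
  [ffun p => t (tag p) *m w p].

Lemma mult_actE (m : 'I_l -> nat) t (w : mult_module m) p :
  mult_act t w p = t (tag p) *m w p.
Proof. exact: ffunE. Qed.

Definition mult_basis (m : 'I_l -> nat) (p : {u : 'I_l & 'I_(m u)}) 
    (v : 'I_(e (tag p))) : mult_module m :=
  [ffun q => \col_x ((q == p) && (x == v :> nat))%:R].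

Lemma mult_basisE (m : 'I_l -> nat) (p : {u : 'I_l & 'I_(m u)}) v :
  mult_basis v p = delta_mx v 0 :> 'cV_(e (tag p)).
Proof. by apply/matrixP=> x y; rewrite ffunE !mxE eqxx ord1 andbT. Qed.

Lemma mult_basis_neq (m : 'I_l -> nat) (p q : {u : 'I_l & 'I_(m u)}) (v : 'I_(e (tag p))) :
  q != p -> mult_basis v q = 0.
Proof. by move=> /negPf ne; apply/matrixP=> x y; rewrite ffunE !mxE ne. Qed.

Lemma mult_basis_expand m (w : mult_module m) :
  w = \sum_p \sum_v w p v 0 *: mult_basis v.
Proof.
apply: dirsum_ext => q; rewrite dirsum_sumE (bigD1 q) //=.
rewrite [X in _ + X]big1 => [|p ne]; last first.
  rewrite dirsum_sumE big1 // => v _.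
  by rewrite dirsumZE mult_basis_neq ?scaler0 // eq_sym.
rewrite addr0 dirsum_sumE [LHS]matrix_sum_delta; apply: eq_bigr => v _.
by rewrite big_ord1 dirsumZE mult_basisE.
Qed.

(** The vectors [mult_basis (org _)] generate the module, so a [T]-linear map is
    determined by its values on them. *)
Lemma mult_basis_act (m : 'I_l -> nat) (p : {u : 'I_l & 'I_(m u)}) (v : 'I_(e (tag p))) :
  mult_basis v = mult_act (munit F v (org (tag p))) (mult_basis (org (tag p))).
Proof.
apply: dirsum_ext => q; rewrite [RHS]ffunE.
have [->|ne] := eqVneq q p; last by rewrite !mult_basis_neq ?mulmx0.
by rewrite munitE !mult_basisE mul_delta_mx.
Qed.

Section Maps.
Variables m n : 'I_l -> nat.

Definition mult_index := {u : 'I_l & ('I_(m u) * 'I_(n u))%type}.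
Definition mult_pair u (c : 'I_(m u)) (c' : 'I_(n u)) : mult_index :=
  Tagged (fun u => ('I_(m u) * 'I_(n u))%type) (c, c').

(** The [T]-linear map that sends the [c]-th copy of the [u]-th simple module to the
    [c']-th one by the scalar [y (mult_pair c c')]. *)
Definition schur_map (y : {ffun mult_index -> F^o}) (w : mult_module m) : mult_module n :=
  [ffun p : {u : 'I_l & 'I_(n u)} => \sum_(c < m (tag p))
     (y (mult_pair c (tagged p)) : F) *:
       (w (Tagged (fun u => 'I_(m u)) c) : 'cV_(e (tag p)))].

Lemma schur_map_act y t w : schur_map y (mult_act t w) = mult_act t (schur_map y w).
Proof.
apply: dirsum_ext => p; rewrite !ffunE mulmx_sumr; apply: eq_bigr => c _.
by rewrite ffunE scalemxAr.
Qed.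

Lemma schur_map_linear y : linear (schur_map y).
Proof.
move=> a w w'; apply: dirsum_ext => p.
rewrite dirsumDE dirsumZE !ffunE scaler_sumr -big_split; apply: eq_bigr => c _.
by rewrite dirsumDE dirsumZE scalerDr !scalerA mulrC.
Qed.

Lemma schur_map_linearl w : linear (schur_map^~ w).
Proof.
move=> a y y'; apply: dirsum_ext => p.
rewrite dirsumDE dirsumZE !ffunE scaler_sumr -big_split; apply: eq_bigr => c _.
by rewrite !ffunE scalerDl scalerA.
Qed.

Definition schur_coef (Y : mult_module m -> mult_module n) : {ffun mult_index -> F^o} :=
  [ffun z => Y (mult_basis (org (tag (Tagged (fun u => 'I_(m u)) (tagged z).1))))
    (Tagged (fun u => 'I_(n u)) (tagged z).2) (org (tag z)) 0].

Lemma schur_mapK y : schur_coef (schur_map y) = y.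
Proof.
apply/ffunP=> -[u [c c']]; rewrite !ffunE /= summxE (bigD1 c) //= big1.
  by rewrite mult_basisE !mxE !eqxx addr0 mulr1.
move=> c1 ne; rewrite !mxE mult_basis_neq ?mxE ?mulr0 //.
by rewrite -tag_eqE /tag_eq eqxx /= tagged_asE.
Qed.

(** Schur's lemma: the image of a generator of the [c]-th copy of the [u]-th simple
    module is moved by [E_v0] of block [u], which kills the other isotypic
    components and sends a vector [z] to [z 0 0] times the [v]-th basis vector. *)
Lemma schur_coefK (Y : mult_module m -> mult_module n) : linear Y ->
  (forall t w, Y (mult_act t w) = mult_act t (Y w)) -> schur_map (schur_coef Y) =1 Y.
Proof.
move=> Yl YT w; apply: dirsum_ext => -[u c']; rewrite ffunE /=.
rewrite {2}(mult_basis_expand w) (linear_bigsum Yl) dirsum_sumE.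
rewrite sum_tagged (bigD1 u) //= [X in _ + X]big1 ?addr0 => [|u' ne]; last first.
  rewrite big1 // => c _; rewrite (linear_comb Yl) dirsum_sumE big1 // => v _.
  by rewrite dirsumZE mult_basis_act YT mult_actE munit_neq ?mul0mx ?scaler0 // eq_sym.
apply: eq_bigr => c _; rewrite (linear_comb Yl) dirsum_sumE.
rewrite [w (Tagged (fun u => 'I_(m u)) c) in LHS]matrix_sum_delta scaler_sumr.
apply: eq_bigr => v _; rewrite big_ord1 dirsumZE.
rewrite mult_basis_act YT mult_actE munitE !ffunE /=.
rewrite scalerA mulrC -scalerA; congr (_ *: _).
apply/matrixP=> x y; rewrite !mxE (bigD1 (org u)) //= big1 => [|z ne]; last first.
  by rewrite !mxE (negPf ne) andbF mul0r.
by rewrite !mxE eqxx !ord1 !andbT addr0 mulrC.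
Qed.

Lemma card_mult_index : #|{: mult_index}| = (\sum_u m u * n u)%N.
Proof.
rewrite card_tagged sumnE big_map big_enum.
by apply: eq_bigr => u _; rewrite card_prod !card_ord.
Qed.

(** The isomorphisms [f1] and [f2] turn [T]-linear matrices into [T]-linear maps
    between multiples of simple modules, which [schur_map] parametrises by one
    scalar for each pair of isomorphic simple summands. *)
Lemma intertwiner_space (d1 d2 : nat) (rho1 : T -> 'M[F]_d1) (rho2 : T -> 'M[F]_d2)
    (f1 : {linear 'cV[F]_d1 -> mult_module m}) (f2 : {linear 'cV[F]_d2 -> mult_module n}) :
  bijective f1 -> bijective f2 ->
  (forall t v, f1 (rho1 t *m v) = mult_act t (f1 v)) ->
  (forall t v, f2 (rho2 t *m v) = mult_act t (f2 v)) ->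
  exists2 U : {vspace 'M[F]_(d2, d1)}, \dim U = (\sum_u m u * n u)%N &
    forall X, X \in U <-> forall t, rho2 t *m X = X *m rho1 t.
Proof.
move=> [g1 f1K g1K] [g2 f2K g2K] f1T f2T.
have g1l := can2_linear f1K g1K; have g2l := can2_linear f2K g2K.
pose B (y : {ffun mult_index -> F^o}) : 'M[F]_(d2, d1) :=
  \matrix_(r, s) g2 (schur_map y (f1 (delta_mx s 0))) r 0.
have BE y v : B y *m v = g2 (schur_map y (f1 v)).
  have h : linear (fun v => g2 (schur_map y (f1 v))).
    by move=> a x x'; rewrite linearP schur_map_linear g2l.
  have vE : v = \sum_s v s 0 *: delta_mx s 0.
    by rewrite {1}[v]matrix_sum_delta; apply: eq_bigr => s _; rewrite big_ord1.
  rewrite {2}vE (linear_comb h); apply/matrixP=> r z.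
  rewrite mxE summxE; apply: eq_bigr => s _.
  by rewrite !mxE !ord1 mulrC.
have Bl : linear B.
  move=> a y y'; apply: mulmx_ext => v.
  by rewrite BE schur_map_linearl g2l mulmxDl -scalemxAl !BE.
pose BL : {linear {ffun mult_index -> F^o} -> 'M[F]_(d2, d1)} :=
  HB.pack B (GRing.isLinear.Build F {ffun mult_index -> F^o} 'M[F]_(d2, d1) *:%R B Bl).
exists (limg (linfun BL)).
  rewrite limg_dim_eq ?dimvf; last first.
    apply/eqP; rewrite -subv0; apply/subvP=> y.
    rewrite memv_cap memvf /= memv_ker -[linfun _ y]/(linfun BL y) lfunE /=.
    rewrite memv0 => /eqP By0; rewrite -[y]schur_mapK; apply/eqP/ffunP=> z.
    rewrite (_ : schur_map y = fun _ => 0) ?ffunE ?dirsum0E ?mxE //.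
    apply/funext=> w; rewrite -[schur_map y w]g2K -[w in schur_map y w]g1K -BE By0 mul0mx.
    exact: linear0.
  (* The dimension of [{ffun mult_index -> F^o}] is by definition
     [#|mult_index| * 1]. *)
  rewrite -card_mult_index; exact: muln1.
move=> X; split=> [/memv_imgP [y _ ->] t|XT].
  rewrite lfunE; apply: mulmx_ext => v; rewrite -!mulmxA !BE; apply: (can_inj f2K).
  by rewrite f2T !g2K f1T schur_map_act.
pose Y w := f2 (X *m g1 w).
have Yl : linear Y by move=> a w w'; rewrite /Y g1l !linearP.
have YT t w : Y (mult_act t w) = mult_act t (Y w).
  rewrite /Y -f2T mulmxA XT -mulmxA; congr (f2 (_ *m _)); apply: (can_inj f1K).
  by rewrite f1T !g1K.
apply/memv_imgP; exists (schur_coef Y); first exact: memvf.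
rewrite lfunE; apply: mulmx_ext => v; rewrite BE schur_coefK //.
by rewrite /Y f1K f2K.
Qed.
End Maps.
End Schur.

(** * The decomposition *)

Section Normalised.
Variables (F : fieldType) (k l : nat) (d : 'I_k -> nat) (e : 'I_l -> nat).
Hypotheses (d_gt0 : forall i, (0 < d i)%N) (e_gt0 : forall u, (0 < e u)%N).
Variable iota : mxprod F e -> mxprod F d.
Variable a : 'I_k -> 'I_l -> nat.
Hypothesis bratteli_a : is_bratteli iota a.

Lemma normalised_intertwiners i j :
  exists2 W : {vspace 'M[F]_(d j, d i)},
    \dim W = (\sum_u a i u * a j u - (i == j))%N &
    forall X, X \in W <->
      intertwines iota X /\ (i == j -> X (org d_gt0 j) (org d_gt0 i) = 0).
Proof.
have [f1 [f1b f1T]] := bratteli_a i; have [f2 [f2b f2T]] := bratteli_a j.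
have [|| U dimU UP] := @intertwiner_space _ _ _ e_gt0 _ _ _ _
    (fun t => iota t i) (fun t => iota t j) _ _ f1b f2b.
- by move=> t v; apply: dirsum_ext => p; rewrite f1T mult_actE.
- by move=> t v; apply: dirsum_ext => p; rewrite f2T mult_actE.
have [ij|ne] := eqVneq i j; last first.
  by exists U => [|X]; rewrite ?subn0 // UP; split=> [|[]].
move: U dimU UP; case: _ / ij {f2 f2b f2T} => U dimU UP.
pose phi (X : 'M[F]_(d i)) : F^o := X (org d_gt0 i) (org d_gt0 i).
have phil : linear phi by move=> c X Y; rewrite /phi !mxE.
pose phiL : {linear 'M[F]_(d i) -> F^o} :=
  HB.pack phi (GRing.isLinear.Build F 'M[F]_(d i) F^o *:%R phi phil).
exists (U :&: lker (linfun phiL))%VS => [|X].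
  rewrite (@hyperplane_dim _ _ _ phiL 1%:M) ?dimU //.
    by apply/UP => t; rewrite mulmx1 mul1mx.
  by rewrite /= /phi mxE eqxx oner_neq0.
rewrite memv_cap memv_ker -[linfun _ X]/(linfun phiL X) lfunE.
split=> [/andP[/UP XT /eqP X0]|[/UP XU /(_ isT) /eqP X0]]; first by split.
by rewrite XU.
Qed.
End Normalised.

Theorem theorem2 (F : closedFieldType) (charF0 : [pchar F] =i pred0)
    (k l : nat) (k_gt0 : (0 < k)%N) (l_gt0 : (0 < l)%N)
    (d : 'I_k -> nat) (d_gt0 : forall i, (0 < d i)%N)
    (e : 'I_l -> nat) (e_gt0 : forall j, (0 < e j)%N)
    (iota : {rmorphism mxprod F e -> mxprod F d})
    (iota_linear : linear iota) (iota_inj : injective iota)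
    (a : 'I_k -> 'I_l -> nat) (bratteli_a : is_bratteli iota a) :
  let r i := ((\sum_(u < l) a i u ^ 2) - 1)%N in
  let r2 i j := (\sum_(u < l) a i u * a j u)%N in
  bimod_iso (der_bimod iota)
    (sum2_bimod
      (dirsum_bimod (fun i : 'I_k => power_bimod (mxbimod F d i i) (r i)))
      (dirsum_bimod (fun p : {p : 'I_k * 'I_k | p.1 != p.2} =>
         power_bimod (mxbimod F d (val p).1 (val p).2)
           (r2 (val p).1 (val p).2)))).
Proof.
move=> r r2.
pose m (p : 'I_k * 'I_k) := (r2 p.1 p.2 - (p.1 == p.2))%N.
pose B p := power_bimod (mxbimod F d p.1 p.2) (m p).
have iso : bimod_iso (der_bimod iota) (dirsum_bimod B).
  apply: (corner_decomposition (d_gt0 := d_gt0)) => p.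
  have [W dimW WP] := normalised_intertwiners d_gt0 e_gt0 bratteli_a p.1 p.2.
  by rewrite /m /r2 -dimW; apply: der_corner_basis.
have diagE i : B (i, i) = power_bimod (mxbimod F d i i) (r i).
  by rewrite /B /m /= eqxx; congr (power_bimod _ (_ - 1)%N).
have offdiagE (p : {p : 'I_k * 'I_k | p.1 != p.2}) :
    B (val p) = power_bimod (mxbimod F d (val p).1 (val p).2) (r2 (val p).1 (val p).2).
  by rewrite /B /m (negPf (valP p)) subn0.
rewrite -(funext diagE) -(funext offdiagE).
exact: (bimod_iso_trans iso (dirsum_split_diag B)).
Qed.
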